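(* Let $n\ge 1$ be an integer and let $[\beta(i,j)]$ be the $n\times n$ real symmetric matrix with $(i,j)$th entry $\beta(i,j)$, $1\le i,j\le n$, where $\beta$ is the beta function. Then $$\mathrm{Inertia}\left([\beta(i,j)]\right)=\begin{cases}\left(\dfrac n2,\,0,\,\dfrac n2\right) & \text{if } n \text{ is even},\\[2mm] \left(\dfrac{n+1}{2},\,0,\,\dfrac{n-1}{2}\right) & \text{if } n\text{ is odd}.\end{cases}$$
   Context: For $x,y>0$, $\beta(x,y)=\frac{\Gamma(x)\Gamma(y)}{\Gamma(x+y)}$, where $\Gamma$ is the gamma function; for positive integers $i,j$, $\beta(i,j)=\frac{(i-1)!(j-1)!}{(i+j-1)!}$. For a real symmetric matrix $A$, let $\pi(A),\xi(A),\nu(A)$ denote the number of positive, zero and negative eigenvalues of $A$, respectively (counted with multiplicity). The inertia of $A$ is the triplet $\mathrm{Inertia}(A)=(\pi(A),\xi(A),\nu(A))$. *)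

(* Defs.v *)
From mathcomp Require Import all_boot all_order all_algebra.
From mathcomp Require Import polyrcf.
From mathcomp Require Import all_classical all_reals all_analysis.

Set Implicit Arguments.
Unset Strict Implicit.
Unset Printing Implicit Defensive.

Import Order.TTheory GRing.Theory Num.Theory.
Local Open Scope ring_scope.

(* Euler's integral. It converges for 0 < x; [Rintegral] returns 0 when the
   integral is infinite, so the value is meaningful for 0 < x only. *)
Definition Gamma (R : realType) (x : R) : R :=
  \int[@lebesgue_measure R]_(t in `]0, +oo[%classic) (t `^ (x - 1) * expR (- t)).

Definition beta (R : realType) (x y : R) : R :=
  Gamma x * Gamma y / Gamma (x + y).

(* Ordinals start at 0, the indices of the matrix at 1: hence the successors. *)
Definition beta_mx (R : realType) (n : nat) : 'M[R]_n :=
  \matrix_(i < n, j < n) beta i.+1%:R j.+1%:R.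

(* [rootsR (char_poly A)] lists the real eigenvalues of A without repetition
   (see [eigenvalue_root_char]); [mup a (char_poly A)] is the algebraic
   multiplicity of a. A real symmetric matrix has no other eigenvalue. *)
Definition count_eigenvalues (R : rcfType) (n : nat) (P : pred R)
    (A : 'M[R]_n) : nat :=
  (\sum_(a <- rootsR (char_poly A) | P a) mup a (char_poly A))%N.

(* Positive, zero and negative eigenvalues, in this order. *)
Definition inertia (R : rcfType) (n : nat) (A : 'M[R]_n) : nat * nat * nat :=
  (count_eigenvalues (fun a => 0 < a) A,
   count_eigenvalues (fun a => a == 0) A,
   count_eigenvalues (fun a => a < 0) A).

(* Main.v *)
(** Write [beta(i+1, j+1) = i! j! / (i+j+1)!]. With the lower triangular matrix
    [P i j = (-1)^j C(i, j) (i+j)! / j!] (a rescaling of the coefficients of the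
    Bessel polynomials, which are orthogonal for the moments [1 / (k+1)!]), the
    entry [(P B) i j] is, up to a factor, the [i]-th finite difference of
    [k |-> (i+k)! / (j+1+k)!]. Iterated differences of such quotients have a
    product formula, which vanishes for [j < i] and is positive for [j = i].
    Hence [P B P^T] is both symmetric and upper triangular, so diagonal, and the
    sign of its [i]-th entry is that of [P i i], that is [(-1)^i]. The inertia
    then follows from Sylvester's law, obtained from the spectral theorem over
    [R[i]] and a dimension count. *)
Require Import Defs.
From mathcomp Require Import all_boot all_order all_algebra.
From mathcomp Require Import polyrcf complex ring zify.
From mathcomp Require Import all_classical all_reals all_analysis.

Set Implicit Arguments.
Unset Strict Implicit.
Unset Printing Implicit Defensive.

Import Order.TTheory GRing.Theory Num.Theory.
Import numFieldNormedType.Exports.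
Local Open Scope classical_set_scope.
Local Open Scope ring_scope.
Local Open Scope sesquilinear_scope.

(** * Eigenvalue counts and Sylvester's law of inertia *)

Lemma count_eigenvalues_prod (R : rcfType) (n : nat) (P : pred R)
    (A : 'M[R]_n) (d : 'rV[R]_n) :
  char_poly A = \prod_i ('X - (d 0 i)%:P) ->
  count_eigenvalues P A = #|[pred i : 'I_n | P (d 0 i)]|.
Proof.
pose s := [seq d 0 i | i <- enum 'I_n].
have -> : \prod_i ('X - (d 0 i)%:P) = \prod_(x <- s) ('X - x%:P).
  by rewrite big_map big_enum.
move=> charA.
have charA0 : char_poly A != 0 by rewrite monic_neq0 ?char_poly_monic.
have -> : #|[pred i : 'I_n | P (d 0 i)]| = count P s.
  by rewrite count_map cardE -size_filter; congr size; rewrite [in RHS]enumT.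
rewrite /count_eigenvalues charA.
under eq_bigr do rewrite mu_prod_XsubC.
have mem_roots x : (x \in rootsR (\prod_(y <- s) ('X - y%:P))) = (x \in s).
  by rewrite -charA -roots_on_rootsR // charA root_prod_XsubC.
pose r := rootsR (\prod_(y <- s) ('X - y%:P)).
(* Double counting: multiplicities are numbers of occurrences in [s], and [rootsR] has no
   repetition, so each [x] of [s] with [P x] equals exactly one [a]. *)
transitivity (\sum_(x <- s) \sum_(a <- r | P a) (x == a))%N.
  rewrite exchange_big /=; apply: eq_bigr => a _.
  by rewrite -sum1_count big_mkcond; apply: eq_bigr => x _ /=; case: eqP.
rewrite -sum1_count [RHS]big_mkcond; apply: eq_big_seq => x xs /=.
have [Px|nPx] := ifP.
  rewrite (big_rem x) ?mem_roots //= Px eqxx big_seq_cond big1 ?addn0 // => a.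
  rewrite mem_rem_uniq ?uniq_roots // inE => /andP[/andP[/negPf]].
  by rewrite eq_sym => ->.
by rewrite big1 // => a Pa; case: eqP => // xa; rewrite -xa nPx in Pa.
Qed.

Lemma diag_congr_card_gt0 (C : numClosedFieldType) (n : nat)
    (M : 'M[C]_n) (d e : 'rV[C]_n) :
  d \is a realmx -> M *m diag_mx d *m M ^t* = diag_mx e ->
  (#|[pred i : 'I_n | (0 < e 0 i)%R]| <= #|[pred i : 'I_n | (0 < d 0 i)%R]|)%N.
Proof.
(* If [e] had more positive entries than [d], some nonzero combination of the
   rows of [M] indexed by [0 < e] would vanish at all indices with [0 < d]; the
   form would be positive for [e] and nonpositive for [d] there. *)
move=> d_real eq_de; rewrite leqNgt; apply/negP=> lt_de.
pose f (k : 'I_#|[pred i : 'I_n | (0 < e 0 i)%R]|) := enum_val k.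
pose g (k : 'I_#|[pred i : 'I_n | (0 < d 0 i)%R]|) := enum_val k.
pose N := mxsub f g M.
have : kermx N != 0.
  rewrite kermx_eq0 /row_free neq_ltn.
  by rewrite (leq_ltn_trans (rank_leq_col N)).
case/rowV0Pn => u /sub_kermxP uN u_neq0.
pose y := u *m rowsub f M.
have form_eq : \sum_k e 0 (f k) * `|u 0 k| ^+ 2 = \sum_j d 0 j * `|y 0 j| ^+ 2.
  have /matrixP/(_ 0 0) : u *m mxsub f f (diag_mx e) *m u ^t*
       = y *m diag_mx d *m y ^t*.
    rewrite -eq_de mxsub_mul -mul_rowsub_mx.
    rewrite /y trmx_mul map_mxM !mulmxA -!mulmxA; do 4 congr (_ *m _).
    by apply/matrixP=> i j; rewrite !mxE.
  have -> : mxsub f f (diag_mx e) = diag_mx (\row_k e 0 (f k)).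
    by apply/matrixP=> i j; rewrite !mxE (inj_eq enum_val_inj).
  rewrite mul_mx_diag mxE [in RHS]mxE.
  move=> eq_form; transitivity (\sum_k (y *m diag_mx d) 0 k * (y ^t*) k 0).
    rewrite -eq_form; apply: eq_bigr => k _.
    by rewrite !mxE mulrAC mulrC -normCK.
  by move: (y) => z; apply: eq_bigr => k _;
    rewrite mul_mx_diag !mxE mulrAC mulrC -normCK.
have : \sum_j d 0 j * `|y 0 j| ^+ 2 <= 0.
  apply: sumr_le0 => j _; have [d_gt0|] := boolP (0 < d 0 j).
    have -> : y 0 j = (u *m N) 0 (enum_rank_in d_gt0 j).
      rewrite !mxE; apply: eq_bigr => k _.
      by rewrite !mxE /g enum_rankK_in.
    by rewrite uN mxE normr0 expr0n mulr0.
  (* The order of [C] is partial: realness of [d] is what turns the negation of [0 < d 0 j] into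
     [d 0 j <= 0]. *)
  rewrite -real_leNgt ?real0 //; last exact: (mxOverP d_real).
  by move=> d_le0; rewrite mulr_le0_ge0 ?exprn_ge0.
rewrite -form_eq; apply/negP; rewrite lt_geF //.
case/rV0Pn: u_neq0 => k uk.
have ef i : 0 < e 0 (f i) by have := enum_valP i.
rewrite (bigD1 k) //= ltr_pwDl //.
  by rewrite mulr_gt0 // exprn_gt0 // normr_gt0.
by apply: sumr_ge0 => i _; rewrite mulr_ge0 ?exprn_ge0 // ltW.
Qed.

(** Over [R[i]] the matrix is Hermitian, hence unitarily diagonalizable with a real spectrum; taking
    real parts brings the spectrum back to [R]. *)
Lemma symmetric_spectral_real (R : rcfType) (n : nat) (A : 'M[R]_n) :
  A^T = A ->
  exists (d : 'rV[R]_n) (S : 'M[R[i]]_n),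
    S \is unitarymx /\
    map_mx (real_complex R) A
      = S ^t* *m diag_mx (map_mx (real_complex R) d) *m S.
Proof.
move=> A_sym; pose Ac := map_mx (real_complex R) A.
have Ac_herm : Ac \is hermsymmx.
  apply: realsym_hermsym.
    apply/is_hermitianmxP; rewrite expr0 scale1r /Ac.
    by apply/matrixP=> i j; rewrite -[in RHS]A_sym !mxE.
  by apply/mxOverP=> i j; rewrite mxE; apply/complex_realP; eexists.
exists (map_mx (@complex.Re R) (spectral_diag Ac)), (spectralmx Ac).
split; first exact: spectral_unitarymx.
suff -> : map_mx (real_complex R) (map_mx (@complex.Re R) (spectral_diag Ac))
    = spectral_diag Ac.
  rewrite -invmx_unitary ?spectral_unitarymx //.
  exact/orthomx_spectralP/hermitian_normalmx.
apply/matrixP=> i j; rewrite [LHS]mxE [in LHS]mxE.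
apply: RRe_real.
exact/mxOverP/hermitian_spectral_diag_real.
Qed.

Lemma char_poly_conj (F : comNzRingType) (n : nat) (D S T : 'M[F]_n) :
  T *m S = 1%:M -> char_poly (T *m D *m S) = char_poly D.
Proof.
move=> TS; rewrite /char_poly /char_poly_mx.
have -> : 'X%:M - map_mx polyC (T *m D *m S)
  = map_mx polyC T *m ('X%:M - map_mx polyC D) *m map_mx polyC S.
  rewrite mulmxBr mulmxBl !map_mxM; congr (_ - _).
  by rewrite scalar_mxC -mulmxA -map_mxM TS map_mx1 mulmx1.
by rewrite !det_mulmx mulrAC -det_mulmx -map_mxM TS map_mx1 det1 mul1r.
Qed.

Lemma card_sign (R : realDomainType) (n : nat) (d : 'rV[R]_n) :
  (#|[pred i : 'I_n | (0 < d 0 i)%R]| + #|[pred i : 'I_n | (d 0 i == 0)%R]|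
    + #|[pred i : 'I_n | (d 0 i < 0)%R]| = n)%N.
Proof.
have cardE (P : pred 'I_n) : #|[pred i | P i]| = (\sum_i P i)%N.
  by rewrite -sum1_card big_mkcond; apply: eq_bigr => i _ /=; rewrite inE; case: P.
rewrite !cardE -!big_split /= -[RHS]card_ord -sum1_card.
by apply: eq_bigr => i _; case: ltrgtP.
Qed.

(** Let [d] be the spectrum of [A]. The dimension count, applied to [d], [e] and then to [- d],
    [- e], shows that [e] has at most as many positive and negative entries as [d]. The entries of
    [e] already make up [n] in total, so both bounds are equalities and [d] has no zero. *)
Lemma inertia_congr_diag (R : rcfType) (n : nat) (A P : 'M[R]_n) (e : 'rV[R]_n) :
  A^T = A -> P *m A *m P^T = diag_mx e -> (forall i, e 0 i != 0) ->
  inertia A = (#|[pred i : 'I_n | (0 < e 0 i)%R]|, 0%N,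
               #|[pred i : 'I_n | (e 0 i < 0)%R]|).
Proof.
move=> A_sym eq_e e_neq0.
have [d [S [S_unitary eq_d]]] := symmetric_spectral_real A_sym.
have char_d : char_poly A = \prod_i ('X - (d 0 i)%:P).
  (* The embedding into [R[i]] is injective on polynomials, so the factorization can be checked
     there, where [A] is similar to a diagonal matrix. *)
  apply: (map_poly_inj (real_complex R)).
  rewrite map_char_poly eq_d char_poly_conj; last first.
    by rewrite -invmx_unitary // mulVmx // unitarymx_unit.
  rewrite -map_diag_mx -map_char_poly char_poly_trig ?diag_mx_is_trig //.
  by congr map_poly; apply: eq_bigr => i _; rewrite mxE eqxx.
pose M := map_mx (real_complex R) P *m S ^t*.
have conj_P : (map_mx (real_complex R) P) ^t* = map_mx (real_complex R) P^T.
  by apply/matrixP=> i j; rewrite !mxE; apply/CrealP/complex_realP; eexists.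
have M_diag : M *m diag_mx (map_mx (real_complex R) d) *m M ^t*
    = diag_mx (map_mx (real_complex R) e).
  rewrite -[RHS]map_diag_mx -eq_e !map_mxM eq_d /M trmx_mul map_mxM trmxCK.
  by rewrite conj_P !mulmxA.
have card_le (f g : 'rV[R]_n) (N : 'M[R[i]]_n) :
   N *m diag_mx (map_mx (real_complex R) f) *m N ^t*
     = diag_mx (map_mx (real_complex R) g) ->
   (#|[pred i : 'I_n | (0 < g 0 i)%R]| <= #|[pred i : 'I_n | (0 < f 0 i)%R]|)%N.
  move=> /diag_congr_card_gt0.
  have cardR (h : 'rV[R]_n) :
    #|[pred i : 'I_n | (0 < map_mx (real_complex R) h 0 i)%R]|
     = #|[pred i : 'I_n | (0 < h 0 i)%R]|.
    by apply: eq_card => i; rewrite !inE mxE ltcR.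
  rewrite !cardR; apply; apply/mxOverP => i j.
  by rewrite mxE; apply/complex_realP; eexists.
have le_pos := card_le _ _ _ M_diag.
have le_neg : (#|[pred i : 'I_n | (e 0 i < 0)%R]|
    <= #|[pred i : 'I_n | (d 0 i < 0)%R]|)%N.
  have := card_le (- d) (- e) M.
  rewrite !map_mxN !raddfN /= -?mulmxN mulmxN mulNmx M_diag => /(_ erefl).
  have cardN (h : 'rV[R]_n) : #|[pred i : 'I_n | (0 < (- h) 0 i)%R]|
     = #|[pred i : 'I_n | (h 0 i < 0)%R]|.
    by apply: eq_card => i; rewrite !inE mxE oppr_gt0.
  by rewrite !cardN.
rewrite /inertia !(count_eigenvalues_prod _ char_d).
have := card_sign e; rewrite (@eq_card0 _ [pred i | e 0 i == 0]); last first.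
  by move=> i; rewrite !inE (negPf (e_neq0 i)).
have eq_counts (p z m q r : nat) : (q <= p -> r <= m -> p + z + m = n ->
    q + 0 + r = n -> (p, z, m) = (q, 0, r))%N.
  by move=> *; congr (_, _, _); lia.
exact: eq_counts (card_sign d).
Qed.

(** * Finite differences and the diagonalization by congruence *)

Lemma alternating_sum_binS (R : comNzRingType) (f : nat -> R) (n : nat) :
  \sum_(k < n.+2) (-1) ^+ k * 'C(n.+1, k)%:R * f k
  = \sum_(k < n.+1) (-1) ^+ k * 'C(n, k)%:R * (f k - f k.+1).
Proof.
under [RHS]eq_bigr do rewrite mulrBr.
rewrite sumrB [in RHS]big_ord_recl [X in _ - X]big_ord_recr /=.
rewrite big_ord_recl big_ord_recr /= !bin0 !binn.
(* Pascal's rule: one binomial continues the sum of the [f k], the other, with its sign shifted,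
   that of the [f k.+1]. *)
under eq_bigr => i _ do rewrite binS natrD mulrDr mulrDl.
rewrite big_split /= opprD !addrA; congr (_ + _); last by rewrite exprS; ring.
rewrite -sumrN -!addrA; congr (_ + (_ + _)).
by apply: eq_bigr => i _; rewrite /bump leq0n add1n exprS; ring.
Qed.

(** One difference of [k |-> (N + k)! / (M + k)!] is [M - N] times the same quotient with [M + 1]
    for [M]; iterating gives the product. *)
Lemma alternating_sum_fact_ratio (R : numFieldType) (r N M : nat) :
  \sum_(k < r.+1) (-1) ^+ k * 'C(r, k)%:R * ((N + k)`!%:R / (M + k)`!%:R)
  = \prod_(s < r) (M%:R - N%:R + s%:R) * (N`!%:R / (M + r)`!%:R) :> R.
Proof.
have fact_neq0 k : k`!%:R != 0 :> R by rewrite pnatr_eq0 -lt0n fact_gt0.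
elim: r M => [|r IHr] M.
  by rewrite big_ord1 big_ord0 expr0 bin0 !addn0 !mul1r.
rewrite (alternating_sum_binS (fun k => (N + k)`!%:R / (M + k)`!%:R)).
transitivity (\sum_(k < r.+1) (M%:R - N%:R)
    * ((-1) ^+ k * 'C(r, k)%:R * ((N + k)`!%:R / (M.+1 + k)`!%:R)) : R).
  apply: eq_bigr => k _; rewrite [RHS]mulrCA; congr (_ * _).
  rewrite !addnS addSn !factS !natrM -[(N + k).+1]addn1 -[(M + k).+1]addn1.
  have := fact_neq0 (M + k)%N.
  have : (M + k + 1)%:R != 0 :> R by rewrite pnatr_eq0 addn1.
  move=> H1 H2; move: H1; rewrite !natrD => H1; field.
  by rewrite -!natrD natrD H2.
rewrite -mulr_sumr IHr big_ord_recl addr0 addSnnS -mulrA; congr (_ * (_ * _)).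
by apply: eq_bigr => i _; rewrite lift0 -!natr1; ring.
Qed.

Definition fact_mx (R : numFieldType) (n : nat) : 'M[R]_n :=
  \matrix_(i, j) (i`!%:R * j`!%:R / (i + j).+1`!%:R).

Lemma trmx_fact_mx (R : numFieldType) (n : nat) : (fact_mx R n)^T = fact_mx R n.
Proof. by apply/matrixP=> i j; rewrite !mxE addnC [_ * i`!%:R]mulrC. Qed.

Definition fact_mx_elim (R : numFieldType) (n : nat) : 'M[R]_n :=
  \matrix_(i, j) ((-1) ^+ j * 'C(i, j)%:R * ((i + j)`!%:R / j`!%:R)).

(** The [k!] of [fact_mx] cancels the denominator of [fact_mx_elim], which leaves the alternating
    sum with [r = N = i] and [M = j + 1]. *)
Lemma elim_mul_fact_mx (R : numFieldType) (n : nat) (i j : 'I_n) :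
  (fact_mx_elim R n *m fact_mx R n) i j =
    j`!%:R * (\prod_(s < i) (j.+1%:R - i%:R + s%:R)) * (i`!%:R / (j.+1 + i)`!%:R).
Proof.
have fact_neq0 k : k`!%:R != 0 :> R by rewrite pnatr_eq0 -lt0n fact_gt0.
rewrite -mulrA -alternating_sum_fact_ratio mulr_sumr !mxE.
pose F (k : nat) : R :=
  j`!%:R * ((-1) ^+ k * 'C(i, k)%:R * ((i + k)`!%:R / (j.+1 + k)`!%:R)).
transitivity (\sum_(k < n) F k).
  apply: eq_bigr => k _; rewrite !mxE /F addSn (addnC k j).
  by field; rewrite !fact_neq0.
(* The terms with [i < k] vanish with ['C(i, k)], so the sum may stop at [i]. *)
rewrite (big_ord_widen _ F (ltn_ord i)).
rewrite [RHS]big_mkcond; apply: eq_bigr => k _; rewrite ltnS.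
by case: leqP => // lt_ik; rewrite /F bin_small // mulr0 mul0r mulr0.
Qed.

Lemma fact_mx_congr_diag (R : numFieldType) (n : nat) :
  exists2 e : 'rV[R]_n,
    fact_mx_elim R n *m fact_mx R n *m (fact_mx_elim R n)^T = diag_mx e
    & forall i : 'I_n, 0 < (-1) ^+ i * e 0 i.
Proof.
set P := fact_mx_elim R n; set B := fact_mx R n.
have B_sym : B^T = B := trmx_fact_mx R n.
have PB0 (i j : 'I_n) : (j < i)%N -> (P *m B) i j = 0.
  move=> lt_ji; rewrite elim_mul_fact_mx.
  (* The factor of index [s = i - (j + 1)] in the product is zero. *)
  have lt_s : (i - j.+1 < i)%N by rewrite ltn_subrL (leq_ltn_trans _ lt_ji).
  rewrite (bigD1 (Ordinal lt_s)) //= natrB // addrA subrK subrr.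
  by rewrite mul0r mulr0 mul0r.
have P0 (i j : 'I_n) : (i < j)%N -> P i j = 0.
  by move=> lt_ij; rewrite mxE bin_small // mulr0 mul0r.
pose D := P *m B *m P^T.
have D_low (i j : 'I_n) : (j < i)%N -> D i j = 0.
  (* In each term either [k < i] and [P *m B] vanishes at [(i, k)], or [j < i <= k] and [P] vanishes
     at [(j, k)]. *)
  move=> lt_ji; rewrite mxE big1 // => k _; rewrite [P^T _ _]mxE.
  have [lt_ki|le_ik] := ltnP k i; first by rewrite PB0 ?mul0r.
  by rewrite P0 ?mulr0 // (leq_trans lt_ji).
have D_sym : D^T = D by rewrite /D !trmx_mul trmxK B_sym mulmxA.
have D_diag i : D i i = (P *m B) i i * P i i.
  rewrite mxE (bigD1 i) //= big1 ?addr0 => [|k neq_ki].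
    by rewrite [P^T _ _]mxE.
  rewrite [P^T _ _]mxE; have [lt_ki|le_ik] := ltnP k i; first by rewrite PB0 ?mul0r.
  by rewrite P0 ?mulr0 // ltn_neqAle eq_sym neq_ki.
exists (\row_i D i i).
  apply/matrixP=> i j; rewrite [RHS]mxE [in RHS]mxE -/D.
  have [->|neq_ij] := eqVneq i j; first by rewrite mulr1n.
  rewrite mulr0n; have [lt_ij|] := ltnP i j; first by rewrite -D_sym mxE D_low.
  by rewrite leq_eqVlt val_eqE eq_sym (negPf neq_ij) => /D_low.
move=> i; rewrite mxE D_diag elim_mul_fact_mx mxE.
rewrite mulrCA binn mulr1 [X in 0 < _ * X]mulrA -signr_odd mulrA.
rewrite -expr2 sqrr_sign mulr1.
have fact_gt0R k : 0 < k`!%:R :> R by rewrite ltr0n fact_gt0.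
rewrite !mulr_gt0 ?invr_gt0 //.
(* On the diagonal the factors are [(i + 1) - i + s = 1 + s]. *)
apply: prodr_gt0 => s _; rewrite -natr1 [_ + 1]addrC addrK.
by rewrite ltr_pwDl.
Qed.

(** * The gamma function at positive integers *)

Lemma cvgy_exprM_expRN (R : realType) (n : nat) :
  x ^+ n * expR (- x) @[x --> +oo%R] --> (0 : R).
Proof.
(* The Taylor term of order [n + 1] bounds [expR x] from below, whence
   [x ^+ n * expR (- x) <= c / x]. *)
pose c : R := n.+1`!%:R.
apply: (@squeeze_cvgr _ _ _ _ (fun=> 0) (fun x => c * x^-1)).
- near=> x.
  have x_gt0 : 0 < x by near: x; apply: nbhs_pinfty_gt; rewrite num_real.
  have xn_ge0 : 0 <= x ^+ n by rewrite exprn_ge0 ?ltW.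
  rewrite mulr_ge0 ?expR_ge0 //= expRN ler_pdivrMr ?expR_gt0 //.
  rewrite -mulrA mulrC -ler_pdivrMr ?ltr0n ?fact_gt0 // ler_pdivlMl //.
  rewrite mulrA -exprS.
  by have := expR_ge1Dxn n (ltW x_gt0); apply: le_trans; rewrite lerDr.
- exact: cvg_cst.
- rewrite -[X in _ --> X](mulr0 c); apply: cvgM; first exact: cvg_cst.
  apply/gtr0_cvgV0; last exact: cvg_id.
  by near=> x; near: x; apply: nbhs_pinfty_gt; rewrite num_real.
Unshelve. all: by end_near. Qed.

(** The antiderivative of [t ^+ n * expR (- t)] obtained by repeated integration by parts,
    normalized to vanish at infinity; the integral is then minus its value at 0. *)
Fixpoint gamma_primitive (R : realType) (n : nat) (t : R) : R :=
  if n is m.+1 then m.+1%:R * gamma_primitive m t - t ^+ m.+1 * expR (- t)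
  else - expR (- t).

Lemma is_derive_gamma_primitive (R : realType) (n : nat) (t : R) :
  is_derive t 1 (@gamma_primitive R n) (t ^+ n * expR (- t)).
Proof.
elim: n => [|n IHn] /=.
  by apply: is_derive_eq; rewrite expr0 mul1r mulrN1 opprK.
have dE : is_derive t 1 (fun t : R => expR (- t)) (- expR (- t)).
  by apply: is_derive_eq; rewrite mulrN1.
have dX : is_derive t 1 (fun t : R => t ^+ n.+1) (n.+1%:R * t ^+ n).
  have := @is_deriveX R R id n.+1 t 1 1 (is_derive_id _ _).
  by rewrite exprfctE /GRing.scale /= mulr1.
have := is_deriveB (is_deriveZ n.+1%:R IHn) (is_deriveM dX dE).
move=> /is_derive_eq; apply.
by rewrite /GRing.scale /=; ring.
Qed.

Lemma gamma_primitive0 (R : realType) (n : nat) :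
  gamma_primitive n (0 : R) = - n`!%:R.
Proof.
elim: n => [|n IHn] /=; first by rewrite oppr0 expR0.
by rewrite IHn expr0n mul0r subr0 mulrN -natrM.
Qed.

Lemma cvgy_gamma_primitive (R : realType) (n : nat) :
  gamma_primitive n x @[x --> +oo%R] --> (0 : R).
Proof.
elim: n => [|n IHn] /=.
  by rewrite -oppr0; apply: cvgN; exact: cvgr_expR.
rewrite -[X in _ --> X](subr0 (0 : R)); apply: cvgB; last exact: cvgy_exprM_expRN.
by rewrite -[X in _ --> X](mulr0 n.+1%:R); apply: cvgM => //; exact: cvg_cst.
Qed.

Lemma Gamma_natS (R : realType) (n : nat) : Gamma n.+1%:R = n`!%:R :> R.
Proof.
pose f (t : R) := t ^+ n * expR (- t).
have cf : continuous f.
  move=> t; apply: cvgM; first exact: exprn_continuous.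
  apply: continuous_comp; first exact: oppr_continuous.
  exact: continuous_expR.
rewrite /Gamma.
transitivity (\int[@lebesgue_measure R]_(t in `]0, +oo[) f t).
  apply: eq_Rintegral => t; rewrite inE /= in_itv /= andbT => t_gt0.
  by rewrite -natr1 addrK powR_mulrn // ltW.
(* The fundamental theorem is applied on the half-line closed at 0; adding this point does not
   change the integral. *)
rewrite /Rintegral integral_itv_obnd_cbnd; last first.
  apply/measurable_realfun.measurable_EFinP; apply: measurable_funTS.
  exact: measurable_realfun.continuous_measurable_fun.
rewrite (@ge0_continuous_FTC2y _ f (gamma_primitive n) 0 0).
- by rewrite gamma_primitive0 -EFinB /= sub0r opprK.
- by move=> t t_ge0; rewrite mulr_ge0 ?exprn_ge0 ?expR_ge0.
- exact: continuous_subspaceT.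
- exact: cvgy_gamma_primitive.
- by move=> t _; case: (is_derive_gamma_primitive n t).
- apply: cvg_at_right_filter.
  apply/differentiable_continuous/derivable1_diffP.
  by case: (is_derive_gamma_primitive n (0 : R)).
- by move=> t _; rewrite derive1E; case: (is_derive_gamma_primitive n t).
Qed.

Lemma beta_mx_fact (R : realType) (n : nat) : beta_mx R n = fact_mx R n.
Proof.
apply/matrixP=> i j; rewrite !mxE /beta -natrD addnS !Gamma_natS.
by rewrite addSn.
Qed.

(** * Counting the alternating signs *)

Lemma card_odd_ord (n : nat) : #|[pred i : 'I_n | odd i]| = n./2.
Proof.
rewrite -sum1_card big_mkcond /=.
transitivity (\sum_(i < n) odd i)%N.
  by apply: eq_bigr => i _; rewrite inE; case: odd.
elim: n => [|n IHn]; first by rewrite big_ord0.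
by rewrite big_ord_recr /= IHn uphalf_half addnC.
Qed.

Theorem theorem1p1 (R : realType) (n : nat) (n_ge1 : (1 <= n)%N) :
  inertia (beta_mx R n) =
    if odd n then ((n.+1 %/ 2)%N, 0%N, (n.-1 %/ 2)%N)
    else ((n %/ 2)%N, 0%N, (n %/ 2)%N).
Proof.
have [e eq_e e_sign] := fact_mx_congr_diag R n.
have e_neq0 i : e 0 i != 0.
  by apply: contraTneq (e_sign i) => ->; rewrite mulr0 ltxx.
have e_neg i : (e 0 i < 0) = odd i.
  have := e_sign i; rewrite -signr_odd; case: odd => /=.
    by rewrite expr1 mulN1r oppr_gt0.
  by rewrite expr0 mul1r => /ltW; rewrite leNgt => /negPf.
have e_pos i : (0 < e 0 i) = ~~ odd i.
  by rewrite -e_neg -leNgt lt_neqAle eq_sym e_neq0.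
have sym : (fact_mx R n)^T = fact_mx R n by exact: trmx_fact_mx.
rewrite beta_mx_fact (inertia_congr_diag sym eq_e e_neq0).
have card_neg : #|[pred i : 'I_n | (e 0 i < 0)%R]| = n./2.
  by rewrite -card_odd_ord; apply: eq_card => i; rewrite !inE e_neg.
(* The positive entries sit at the even indices, the complement of the odd ones. *)
have card_pos : #|[pred i : 'I_n | (0 < e 0 i)%R]| = (n - n./2)%N.
  rewrite -card_odd_ord -[X in (X - _)%N]card_ord -(cardC [pred i : 'I_n | odd i]).
  by rewrite addKn; apply: eq_card => i; rewrite !inE e_pos.
rewrite card_neg card_pos; case: ifP => n_odd; congr (_, _, _); lia.
Qed.
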